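(* Let $\phi$ be a posterior family for a model $\pi$ with data space $Y$ and parameter space $\Theta$, and let $f$ be a test quantity. For every $M\in\mathbb{N}$: (1) for any $y\in Y$, if $q_{\phi,f}(x\mid y)=x$ for all $x\in[0,1]$, then $Q_{\phi,f}(i\mid y)=\frac{i+1}{M+1}$ for all $i\in\{0,\dots,M-1\}$; (2) if $\phi$ passes continuous SBC with respect to $f$, then $\phi$ passes $M$-sample SBC with respect to $f$.
   Context: Model $\pi$: prior density $\pi_{\text{prior}}(\theta)$ on $\Theta$, observation density $\pi_{\text{obs}}(y\mid\theta)$ on $Y$, $\pi_{\text{marg}}(y)=\int_\Theta\pi_{\text{obs}}(y\mid\theta)\pi_{\text{prior}}(\theta)\,\mathrm{d}\theta$, $\pi_{\text{post}}(\theta\mid y)=\pi_{\text{obs}}(y\mid\theta)\pi_{\text{prior}}(\theta)/\pi_{\text{marg}}(y)$. A posterior family is $\phi:\Theta\times Y\to\mathbb{R}^+$ with $\int_\Theta\phi(\theta\mid y)\,\mathrm{d}\theta=1$ for all $y$; a test quantity is a measurable $f:\Theta\times Y\to\mathbb{R}$. Sample quantities: for $M\in\mathbb{N}$, $\theta_1,\dots,\theta_M$ i.i.d. from $\phi(\cdot\mid y)$, $N^{\mathtt{less}}=\sum_m\mathbb{I}[f(\theta_m,y)<f(\tilde\theta,y)]$, $N^{\mathtt{equals}}=\sum_m\mathbb{I}[f(\theta_m,y)=f(\tilde\theta,y)]$, $K$ uniform on $\{0,\dots,N^{\mathtt{equals}}\}$, $N^{\mathtt{total}}=N^{\mathtt{less}}+K$;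 $R_{\phi,f}(i\mid\tilde\theta,y)=\Pr(N^{\mathtt{total}}\le i)$; $Q_{\phi,f}(i\mid y)=\int_\Theta\pi_{\text{post}}(\tilde\theta\mid y)R_{\phi,f}(i\mid\tilde\theta,y)\,\mathrm{d}\tilde\theta$; $\phi$ passes $M$-sample SBC w.r.t. $f$ if $\int_YQ_{\phi,f}(i\mid y)\pi_{\text{marg}}(y)\,\mathrm{d}y=\frac{i+1}{M+1}$ for all $i\in\{0,\dots,M-1\}$. Continuous quantities: $C_{\phi,f}(s\mid y)=\int_\Theta\mathbb{I}[f(\theta,y)\le s]\phi(\theta\mid y)\,\mathrm{d}\theta$, $D_{\phi,f}(s\mid y)=\int_\Theta\mathbb{I}[f(\theta,y)=s]\phi(\theta\mid y)\,\mathrm{d}\theta$; with $U\sim\mathrm{uniform}[0,1]$, $r_{\phi,f}(x\mid\tilde\theta,y)=\Pr\big(C_{\phi,f}(f(\tilde\theta,y)\mid y)-U\,D_{\phi,f}(f(\tilde\theta,y)\mid y)\le x\big)$, $q_{\phi,f}(x\mid y)=\int_\Theta\pi_{\text{post}}(\tilde\theta\mid y)r_{\phi,f}(x\mid\tilde\theta,y)\,\mathrm{d}\tilde\theta$. $\phi$ passes continuous SBC w.r.t. $f$ if $\int_Yq_{\phi,f}(x\mid y)\pi_{\text{marg}}(y)\,\mathrm{d}y=x$ for all $x\in[0,1]$. *)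

(* Defs.v *)
From HB Require Import structures.
From mathcomp Require Import all_boot all_order all_algebra.
From mathcomp Require Import all_classical all_reals all_analysis.
Set Implicit Arguments. Unset Strict Implicit. Unset Printing Implicit Defensive.
Import Order.TTheory GRing.Theory Num.Theory.
Local Open Scope classical_set_scope.
Local Open Scope ring_scope.

Section SBC.
Context {R : realType} {dT dY : measure_display}
  {Theta : measurableType dT} {Y : measurableType dY}.
Variables (muT : {measure set Theta -> \bar R}) (muY : {measure set Y -> \bar R}).

Definition is_model (prior : Theta -> R) (obs : Y -> Theta -> R) : Prop :=
  [/\ measurable_fun setT prior, (forall t, 0 <= prior t) &
      (\int[muT]_t (prior t)%:E = 1)%E] /\
  [/\ measurable_fun setT (fun p : Y * Theta => obs p.1 p.2),
      (forall y t, 0 <= obs y t) &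
      forall t, (\int[muY]_y (obs y t)%:E = 1)%E].

Definition marg (prior : Theta -> R) (obs : Y -> Theta -> R) (y : Y) : \bar R :=
  (\int[muT]_t (obs y t * prior t)%:E)%E.

(* pi_post(t | y); where pi_marg(y) is 0 or +oo, the convention x/0 = 0 is used *)
Definition post (prior : Theta -> R) (obs : Y -> Theta -> R) (t : Theta) (y : Y) : R :=
  obs y t * prior t / fine (marg prior obs y).

Definition posterior_family (phi : Theta -> Y -> R) : Prop :=
  [/\ measurable_fun setT (fun p : Theta * Y => phi p.1 p.2),
      (forall t y, 0 <= phi t y) &
      forall y, (\int[muT]_t (phi t y)%:E = 1)%E].

Definition test_quantity (f : Theta -> Y -> R) : Prop :=
  measurable_fun setT (fun p : Theta * Y => f p.1 p.2).

(* Expectation of g(theta_1,...,theta_M) for theta_1..theta_M i.i.d. from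
   phi(. | y): iterated integral against the product of M copies of the
   distribution with density phi(. | y). *)
Fixpoint iid_expect (phi : Theta -> Y -> R) (y : Y) (M : nat)
    (g : seq Theta -> \bar R) {struct M} : \bar R :=
  match M with
  | 0%N => g [::]
  | M'.+1 => (\int[muT]_t ((phi t y)%:E * iid_expect phi y M' (fun s => g (t :: s))))%E
  end.

Definition Nless (f : Theta -> Y -> R) (tt : Theta) (y : Y) (s : seq Theta) : nat :=
  count (fun t => f t y < f tt y) s.
Definition Nequals (f : Theta -> Y -> R) (tt : Theta) (y : Y) (s : seq Theta) : nat :=
  count (fun t => f t y == f tt y) s.

(* Pr(N^less + K <= i | samples), K uniform on {0,...,N^equals} *)
Definition prob_Ntotal_le (f : Theta -> Y -> R) (tt : Theta) (y : Y) (i : nat)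
    (s : seq Theta) : R :=
  (\sum_(k < (Nequals f tt y s).+1) ((Nless f tt y s + k <= i)%N)%:R)
    / ((Nequals f tt y s).+1)%:R.

Definition Rrank (phi f : Theta -> Y -> R) (M i : nat) (tt : Theta) (y : Y) : \bar R :=
  iid_expect phi y M (fun s => (prob_Ntotal_le f tt y i s)%:E).

Definition Qrank (prior : Theta -> R) (obs : Y -> Theta -> R) (phi f : Theta -> Y -> R)
    (M i : nat) (y : Y) : \bar R :=
  (\int[muT]_tt ((post prior obs tt y)%:E * Rrank phi f M i tt y))%E.

Definition Ccdf (phi f : Theta -> Y -> R) (s : R) (y : Y) : \bar R :=
  (\int[muT]_(t in [set t | (f t y <= s)%R]) (phi t y)%:E)%E.
Definition Dmass (phi f : Theta -> Y -> R) (s : R) (y : Y) : \bar R :=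
  (\int[muT]_(t in [set t | f t y = s]) (phi t y)%:E)%E.

(* r_{phi,f}(x | tt, y) = Pr_U(C(f(tt,y)|y) - U D(f(tt,y)|y) <= x), U ~ uniform[0,1] *)
Definition rcont (phi f : Theta -> Y -> R) (x : R) (tt : Theta) (y : Y) : \bar R :=
  lebesgue_measure ([set u : R | 0 <= u <= 1] `&`
    [set u : R | (Ccdf phi f (f tt y) y - u%:E * Dmass phi f (f tt y) y <= x%:E)%E]).

Definition qcont (prior : Theta -> R) (obs : Y -> Theta -> R) (phi f : Theta -> Y -> R)
    (x : R) (y : Y) : \bar R :=
  (\int[muT]_tt ((post prior obs tt y)%:E * rcont phi f x tt y))%E.

Definition passes_M_SBC (prior : Theta -> R) (obs : Y -> Theta -> R)
    (phi f : Theta -> Y -> R) (M : nat) : Prop :=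
  forall i : nat, (i < M)%N ->
    (\int[muY]_y (Qrank prior obs phi f M i y * marg prior obs y))%E
      = (i.+1%:R / M.+1%:R)%:E.

Definition passes_continuous_SBC (prior : Theta -> R) (obs : Y -> Theta -> R)
    (phi f : Theta -> Y -> R) : Prop :=
  forall x : R, 0 <= x <= 1 ->
    (\int[muY]_y (qcont prior obs phi f x y * marg prior obs y))%E = x%:E.

End SBC.

(* Main.v *)
Require Import Defs.
From HB Require Import structures.
From mathcomp Require Import all_boot all_order all_algebra.
From mathcomp Require Import all_classical all_reals all_analysis.
From mathcomp Require Import measurable_realfun ring lra.
Import Order.TTheory GRing.Theory Num.Theory.
Import numFieldNormedType.Exports.
Local Open Scope classical_set_scope.
Local Open Scope ring_scope.

(** Write c and d for the values of C and D at f(tt, y). Breaking ties uniformly makes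
    each of the M samples fall below rank level independently with probability c - U d,
    for a single uniform U, so R(i | tt, y) is the U-average of Pr(Bin(M, c - U d) <= i).
    The binomial tail v |-> Pr(Bin(M, v) <= i) decreases to 0 at v = 1, hence it equals the
    integral of a nonnegative density b over [v, 1]. Exchanging integrals (Tonelli) gives
    R(i | .) = int b(x) r(x | .) dx, and then the same relation between Q and q and between
    their averages over Y. Both claims follow from int_0^1 b(x) x dx = (i+1)/(M+1). *)

(* With g = at_most i, n iterations compute, at a, the probability that a plus a
   Binomial(n, w) variable is at most i; w may be a number or a polynomial. *)
Definition bernoulli_step {A : pzRingType} (w : A) (g : nat -> A) (a : nat) : A :=
  w * g a.+1 + (1 - w) * g a.

Definition at_most {A : pzRingType} (i a : nat) : A := (a <= i)%N%:R.

Lemma bernoulli_stepE (A : pzRingType) (w : A) (g : nat -> A) (a : nat) :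
  bernoulli_step w g a = w * g a.+1 + (1 - w) * g a.
Proof. by []. Qed.

Lemma bernoulli_stepC (A : comPzRingType) (v w : A) (g : nat -> A) :
  bernoulli_step v (bernoulli_step w g) = bernoulli_step w (bernoulli_step v g).
Proof. by apply/funext => a; rewrite /bernoulli_step; ring. Qed.

Lemma iter_bernoulli_stepC (A : comPzRingType) (v w : A) (g : nat -> A) (n : nat) :
  iter n (bernoulli_step v) (bernoulli_step w g) =
  bernoulli_step w (iter n (bernoulli_step v) g).
Proof. by elim: n => //= n ->; rewrite bernoulli_stepC. Qed.

Lemma iter_bernoulli_step1 (A : comPzRingType) (g : nat -> A) (n a : nat) :
  iter n (bernoulli_step 1) g a = g (a + n)%N.
Proof.
elim: n a => [|n IHn] a /=; first by rewrite addn0.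
by rewrite bernoulli_stepE subrr mul1r mul0r addr0 IHn addSnnS.
Qed.

Lemma iter_bernoulli_step0 (A : comPzRingType) (g : nat -> A) (n a : nat) :
  iter n (bernoulli_step 0) g a = g a.
Proof.
elim: n a => [|n IHn] a //=.
by rewrite bernoulli_stepE subr0 mul1r mul0r add0r IHn.
Qed.

Lemma horner_iter_bernoulli_step (A : comNzRingType) (w : {poly A}) (i n a : nat) (x : A) :
  (iter n (bernoulli_step w) (at_most i) a).[x] =
  iter n (bernoulli_step w.[x]) (at_most i) a.
Proof.
elim: n a => [|n IHn] a /=; first by rewrite /at_most -polyC_natr hornerC.
by rewrite bernoulli_stepE !hornerE !IHn.
Qed.

Lemma deriv_iter_bernoulli_step (A : comNzRingType) (w : {poly A}) (i n a : nat) :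
  let G m := iter m (bernoulli_step w) (at_most i) in
  (G n.+1 a)^`() = w^`() * (G n a.+1 - G n a) *+ n.+1.
Proof.
move=> G; elim: n a => [|n IHn] a.
  rewrite /= bernoulli_stepE.
  have D k : ((at_most i k : {poly A}))^`() = 0 by rewrite /at_most -polyC_natr derivC.
  by rewrite derivD !derivM derivB derivC !D /=; ring.
have -> : G n.+2 a = w * G n.+1 a.+1 + (1 - w) * G n.+1 a by [].
rewrite derivD !derivM derivB derivC !IHn.
have E b : G n.+1 b = w * G n b.+1 + (1 - w) * G n b by [].
rewrite !E; ring.
Qed.

Lemma iter_bernoulli_step_decr (F : realFieldType) (x : F) (i n a : nat) :
  0 <= x <= 1 ->
  iter n (bernoulli_step x) (at_most i) a.+1 <=
  iter n (bernoulli_step x) (at_most i) a.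
Proof.
move=> /andP[x0 x1]; elim: n a => [|n IHn] a /=.
  by rewrite /at_most ler_nat; case: ltnP => // /ltnW ->.
by rewrite bernoulli_stepE lerD// ler_wpM2l// subr_ge0.
Qed.

Section poly_integral.
Context {R : realType}.
Implicit Types p q w : {poly R}.

Definition mean p : R := \int[lebesgue_measure]_(x in `[0, 1]) p.[x].

Lemma integrable_horner p (a b : R) :
  lebesgue_measure.-integrable `[a, b] (fun x => (p.[x])%:E).
Proof.
apply: continuous_compact_integrable; first exact: segment_compact.
exact/continuous_subspaceT/continuous_horner.
Qed.

Lemma meanD p q : mean (p + q) = mean p + mean q.
Proof.
rewrite /mean -RintegralD//; try exact: integrable_horner.
by apply: eq_Rintegral => x _; rewrite hornerD.
Qed.

Lemma meanZ c p : mean (c *: p) = c * mean p.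
Proof.
rewrite /mean -RintegralZl//; last exact: integrable_horner.
by apply: eq_Rintegral => x _; rewrite hornerZ.
Qed.

Lemma meanN p : mean (- p) = - mean p.
Proof. by rewrite -scaleN1r meanZ mulN1r. Qed.

Lemma integral_deriv p (a b : R) : a <= b ->
  (\int[lebesgue_measure]_(x in `[a, b]) (p^`().[x])%:E = (p.[b] - p.[a])%:E)%E.
Proof.
rewrite le_eqVlt => /predU1P[->|ab]; first by rewrite set_itv1 integral_set1 subrr.
rewrite (continuous_FTC2 ab (F := horner p)) ?EFinB//.
- exact/continuous_subspaceT/continuous_horner.
- split => [x _||]; first exact: derivable_horner.
  + exact/cvg_at_right_filter/continuous_horner.
  + exact/cvg_at_left_filter/continuous_horner.
- by move=> x _; rewrite derivE.
Qed.

Lemma mean_deriv p : mean p^`() = p.[1] - p.[0].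
Proof. by rewrite /mean /Rintegral integral_deriv. Qed.

Lemma integral_mean p :
  (\int[lebesgue_measure]_(x in `[0%R, 1%R]) (p.[x])%:E = (mean p)%:E)%E.
Proof.
rewrite /mean /Rintegral fineK//.
apply: integrable_fin_num => //; exact: integrable_horner.
Qed.

(* A Binomial(n, U) variable with U uniform on [0, 1] is uniform on {0, ..., n}. *)
Lemma mean_iter_bernoulli_step w (i n a : nat) :
  w = 'X \/ w = 1 - 'X ->
  mean (iter n (bernoulli_step w) (at_most i) a) =
  (\sum_(k < n.+1) (a + k <= i)%N%:R) / n.+1%:R.
Proof.
move=> hw; pose G m := iter m (bernoulli_step w) (at_most i).
rewrite -/(G n).
have G0 b : (i < b)%N -> G n b = 0.
  move=> ib; rewrite /G; elim: n b ib => [|m IHm] b ib /=.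
    by rewrite /at_most leqNgt ib.
  by rewrite bernoulli_stepE !IHm ?mulr0 ?addr0 // ltnW.
have GE b : n.+1%:R * (mean (G n b) - mean (G n b.+1)) =
    (b <= i)%N%:R - (b + n.+1 <= i)%N%:R.
  have := mean_deriv (G n.+1 b).
  rewrite deriv_iter_bernoulli_step -/G -scaler_nat meanZ !horner_iter_bernoulli_step.
  case: hw => hw.
    rewrite {1}hw derivX mul1r meanD meanN hw !hornerX.
    rewrite iter_bernoulli_step1 iter_bernoulli_step0.
    by rewrite -hw => E; rewrite -[LHS]opprK -mulrN opprB E opprB.
  rewrite {1}hw derivB derivC derivX sub0r mulN1r opprB meanD meanN hw !hornerE.
  by rewrite -hw subrr subr0 iter_bernoulli_step1 iter_bernoulli_step0.
have SE b : \sum_(k < n.+1) (b + k <= i)%N%:R - \sum_(k < n.+1) (b.+1 + k <= i)%N%:R =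
    (b <= i)%N%:R - (b + n.+1 <= i)%N%:R :> R.
  rewrite big_ord_recl big_ord_recr /= addn0 addSnnS.
  under eq_bigr do rewrite /bump leq0n add1n -addSnnS.
  ring.
have n0 : n.+1%:R != 0 :> R by rewrite pnatr_eq0.
rewrite -/(G n a); apply: (mulfI n0); rewrite mulrCA divff// mulr1.
have [m] := ubnP (i.+1 - a)%N; elim: m a => // m IHm a am.
have [ia|ai] := ltnP i a.
  rewrite G0// -(scale0r 0) meanZ mul0r mulr0 big1// => k _.
  by rewrite leqNgt (leq_trans ia) ?leq_addr.
have := GE a; rewrite -SE mulrBr (IHm a.+1); last by rewrite -ltnS subnSK.
by move/addIr.
Qed.
End poly_integral.

Lemma sigma_finite_measureP (R : realType) (d : measure_display) (T : measurableType d)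
    (mu : {measure set T -> \bar R}) : sigma_finite setT mu ->
  exists m : {sigma_finite_measure set T -> \bar R}, (m : {measure set T -> \bar R}) = mu.
Proof.
move=> sf.
pose H1 := @isSFinite.Build d T R mu (sfinite_measure_sigma_finite sf).
pose H2 := isSigmaFinite.Build _ _ _ mu sf.
by exists (HB.pack_for {sigma_finite_measure set T -> \bar R} (Measure.sort mu) H1 H2);
  apply: eq_measure.
Qed.

Section binomial_tail.
Context {R : realType}.

(* As a polynomial in x, the probability that a Binomial(M, x) variable is at most i. *)
Definition binomial_tail (M i : nat) : {poly R} :=
  iter M (bernoulli_step 'X) (at_most i) 0%N.

(* The density of the (i+1)-st smallest of M uniform samples of [0, 1]. *)
Definition order_density (M i : nat) (x : R) : R :=
  if 0 <= x <= 1 then - (binomial_tail M i)^`().[x] else 0.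

Lemma order_density_ge0 M i x : 0 <= order_density M i x.
Proof.
rewrite /order_density; case: ifP => // x01.
case: M => [|M]; first by rewrite /binomial_tail /= /at_most -polyC_natr derivC hornerC oppr0.
rewrite /binomial_tail deriv_iter_bernoulli_step derivX mul1r hornerMn hornerD hornerN.
rewrite -mulNrn mulrn_wge0// opprB subr_ge0 !horner_iter_bernoulli_step hornerX.
exact: iter_bernoulli_step_decr.
Qed.

Lemma measurable_order_density M i : measurable_fun setT (order_density M i).
Proof.
apply: measurable_fun_ifT => //.
- by apply: measurable_and; apply: measurable_fun_ler.
- by apply: measurableT_comp => //; exact: measurable_poly.
Qed.

Lemma binomial_tail1 M i : (i < M)%N -> (binomial_tail M i).[1] = 0.
Proof.
move=> iM; rewrite horner_iter_bernoulli_step hornerX iter_bernoulli_step1.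
by rewrite /at_most add0n leqNgt iM.
Qed.

Lemma integral_order_density_ge M i v : (i < M)%N -> 0 <= v <= 1 ->
  (\int[lebesgue_measure]_x (if (v <= x)%R then order_density M i x else 0)%:E =
   (binomial_tail M i).[v]%:E)%E.
Proof.
move=> iM /andP[v0 v1].
rewrite -[RHS](_ : (\int[lebesgue_measure]_(x in `[v, 1%R])
   ((- binomial_tail M i)%R^`().[x])%:E = _)%E); last first.
  by rewrite integral_deriv// !hornerN binomial_tail1// oppr0 sub0r opprK.
rewrite [RHS]integral_mkcond; apply: eq_integral => x _.
rewrite patchE mem_setE in_itv /= /order_density.
case: (leP v x) => //= vx; rewrite (le_trans v0 vx) /=.
by case: ifP => //; rewrite derivN hornerN.
Qed.

Lemma integral_order_density_id M i : (i < M)%N ->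
  (\int[lebesgue_measure]_x (order_density M i x * x)%:E =
   (i.+1%:R / M.+1%:R)%:E)%E.
Proof.
move=> iM; set T := binomial_tail M i.
transitivity (\int[lebesgue_measure]_(x in `[0%R, 1%R]) (((T - (T * 'X)^`())%R.[x])%:E))%E.
  rewrite [RHS]integral_mkcond; apply: eq_integral => x _.
  rewrite patchE mem_setE in_itv /= /order_density -/T.
  case: ifP => // _; last by rewrite mul0r.
  by rewrite derivM derivX !hornerE; congr EFin; ring.
rewrite integral_mean meanD meanN mean_deriv !hornerE binomial_tail1//.
rewrite !subr0 mean_iter_bernoulli_step; last by left.
congr (_ / _)%:E.
rewrite -(big_mkord predT (fun k => ((0 + k <= i)%N%:R : R))).
rewrite (big_cat_nat (n := i.+1))//=; last by rewrite ltnW.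
rewrite [X in _ + X]big_nat_cond [X in _ + X]big1 ?addr0; last first.
  by move=> k /andP[/andP[ik _] _]; rewrite leqNgt ik.
rewrite big_nat_cond (eq_bigr (fun=> 1)); last first.
  by move=> k /andP[/andP[_ ki] _]; rewrite -ltnS ki.
by rewrite -big_nat_cond big_mkord sumr_const card_ord.
Qed.
End binomial_tail.

Section rank_statistics.
Context {R : realType} {dT dY : measure_display}
  {Theta : measurableType dT} {Y : measurableType dY}
  (mu : {sigma_finite_measure set Theta -> \bar R}) (phi f : Theta -> Y -> R)
  (Hphi : posterior_family mu phi) (Hf : test_quantity f).

Let phi_ge0 t y : 0 <= phi t y. Proof. by case: Hphi. Qed.

Let measurable_phi : measurable_fun setT (fun p : Theta * Y => phi p.1 p.2).
Proof. by case: Hphi. Qed.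

Let measurable_phi_y y : measurable_fun setT (phi ^~ y).
Proof. exact: (measurable_fun_pair1 y measurable_phi). Qed.

Let measurable_f_y y : measurable_fun setT (f ^~ y).
Proof. exact: (measurable_fun_pair1 y Hf). Qed.

Let measurable_le y s : measurable [set t | f t y <= s].
Proof.
rewrite -[X in measurable X]setTI.
exact: (measurable_fun_ler (measurable_f_y y) (measurable_cst s)).
Qed.

Let measurable_eq y s : measurable [set t | f t y = s].
Proof.
rewrite (_ : [set _ | _] = setT `&` [set t | f t y == s]).
  exact: (measurable_fun_eqr (measurable_f_y y) (measurable_cst s)).
by rewrite setTI; apply/seteqP; split=> t /= /eqP.
Qed.

Let integrable_phi y D : measurable D -> mu.-integrable D (fun t => (phi t y)%:E).
Proof.
move=> mD; apply: (@integrableS _ _ _ mu setT) => //.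
apply/integrableP; split; first exact/measurable_EFinP.
under eq_integral do rewrite gee0_abs ?lee_fin ?phi_ge0//.
by case: Hphi => _ _ ->; rewrite ltry.
Qed.

Definition cdf (s : R) (y : Y) : R := fine (Ccdf mu phi f s y).
Definition atom (s : R) (y : Y) : R := fine (Dmass mu phi f s y).

Lemma CcdfE s y : Ccdf mu phi f s y = (cdf s y)%:E.
Proof. by rewrite fineK// integrable_fin_num//; exact: integrable_phi. Qed.

Lemma DmassE s y : Dmass mu phi f s y = (atom s y)%:E.
Proof. by rewrite fineK// integrable_fin_num//; exact: integrable_phi. Qed.

Lemma atom_ge0 s y : 0 <= atom s y.
Proof. by apply: fine_ge0; apply: integral_ge0 => t _; rewrite lee_fin. Qed.

Lemma atom_le_cdf s y : atom s y <= cdf s y.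
Proof.
rewrite -lee_fin -DmassE -CcdfE; apply: ge0_subset_integral => //.
- by apply/measurable_EFinP; exact: measurable_funTS.
- by move=> t _; rewrite lee_fin.
- by move=> t /= ->.
Qed.

Lemma cdf_le1 s y : cdf s y <= 1.
Proof.
rewrite -lee_fin -CcdfE; case: Hphi => _ _ /(_ y) <-; apply: ge0_subset_integral => //.
  exact/measurable_EFinP.
by move=> t _; rewrite lee_fin.
Qed.

Lemma integral_phi_compare s y (a b c : R) :
  (\int[mu]_t ((phi t y)%:E *
     (if (f t y < s)%R then a else if f t y == s then b else c)%:E) =
   (c + (a - c) * cdf s y + (b - a) * atom s y)%:E)%E.
Proof.
pose g D := (phi ^~ y) \_ D.
have ig D : measurable D -> mu.-integrable setT (EFin \o g D).
  by move=> mD; rewrite -restrict_EFin; apply: (iffLR (integrable_mkcond _ mD));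
    exact: integrable_phi.
have Eg D : measurable D -> (\int[mu]_t (g D t)%:E = \int[mu]_(t in D) (phi t y)%:E)%E.
  by move=> mD; rewrite [RHS]integral_mkcond restrict_EFin.
have gE D t : g D t = if t \in D then phi t y else 0 by rewrite /g patchE.
transitivity (\int[mu]_t ((c%:E * (g setT t)%:E + (a - c)%:E * (g [set t | f t y <= s] t)%:E)
   + (b - a)%:E * (g [set t | f t y = s] t)%:E))%E.
  apply: eq_integral => t _; rewrite !gE in_setT -!EFinM -!EFinD; congr EFin.
  have -> : (t \in [set t | f t y <= s]) = (f t y <= s) by apply/idP/idP; rewrite inE.
  have -> : (t \in [set t | f t y = s]) = (f t y == s) by apply/idP/eqP; rewrite inE.
  by case: ltgtP => _; ring.
rewrite integralD//; last 2 first.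
- by apply: integrableD => //; apply: integrableZl => //; exact: ig.
- by apply: integrableZl => //; exact: ig.
rewrite integralD//; try by apply: integrableZl => //; exact: ig.
rewrite !integralZl//; try exact: ig.
rewrite !Eg//; case: Hphi => _ _ ->.
by rewrite -/(Ccdf mu phi f s y) -/(Dmass mu phi f s y) CcdfE DmassE !EFinD !EFinM mule1.
Qed.

Let accept (i a e : nat) : R := (\sum_(k < e.+1) (a + k <= i)%N%:R) / e.+1%:R.

(* Randomising a tie-break uniformly over e.+1 ranks amounts to drawing w uniformly
   from [0, 1] and letting each of the e ties count with probability 1 - w; the
   other samples then each count with probability cdf - w * atom. *)
Lemma iid_expect_accept tt y M i a e :
  iid_expect mu phi y M (fun s => (accept i (a + Nless f tt y s) (e + Nequals f tt y s))%:E) =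
  (mean (iter M (bernoulli_step ((cdf (f tt y) y)%:P - atom (f tt y) y *: 'X))
     (iter e (bernoulli_step (1 - 'X)) (at_most i)) a))%:E.
Proof.
set c := cdf _ _; set d := atom _ _; set w := _ - _.
elim: M a e => [|M IHM] a e /=.
  by rewrite !addn0 mean_iter_bernoulli_step//; right.
pose S e' a' := mean
  (iter M (bernoulli_step w) (iter e' (bernoulli_step (1 - 'X)) (at_most i)) a').
transitivity (\int[mu]_t ((phi t y)%:E *
    (if (f t y < f tt y)%R then S e a.+1
     else if f t y == f tt y then S e.+1 a else S e a)%:E))%E.
  apply: eq_integral => t _; congr (_ * _)%E.
  transitivity (iid_expect mu phi y M (fun s =>
    (accept i (a + (f t y < f tt y)%R + Nless f tt y s)
              (e + (f t y == f tt y) + Nequals f tt y s))%:E)).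
    by congr (iid_expect mu phi y M _); apply/funext => s; rewrite /Nless /Nequals /= !addnA.
  rewrite IHM; case: ltgtP => _ /=; by rewrite ?addn0 ?addn1.
rewrite integral_phi_compare -/c -/d; congr EFin.
rewrite /S iterS iter_bernoulli_stepC !bernoulli_stepE.
set P := iter M _ _ a.+1; set Q := iter M _ _ a.
have -> : w * P + (1 - w) * Q =
    Q + c *: P - c *: Q + d *: ((1 - 'X) * P + (1 - (1 - 'X)) * Q - P).
  by rewrite /w -!mul_polyC; ring.
by rewrite !(meanD, meanN, meanZ); ring.
Qed.

Lemma RrankE M i tt y :
  Rrank mu phi f M i tt y =
  (\int[lebesgue_measure]_(u in `[0%R, 1%R])
     ((binomial_tail M i).[cdf (f tt y) y - u * atom (f tt y) y])%:E)%E.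
Proof.
rewrite /Rrank (iid_expect_accept tt y M i 0 0) -integral_mean.
apply: eq_integral => u _.
rewrite !horner_iter_bernoulli_step hornerX.
by rewrite hornerD hornerN hornerC hornerZ hornerX mulrC.
Qed.

Lemma rcontE x tt y :
  rcont mu phi f x tt y = (\int[lebesgue_measure]_u
    (if ((0 <= u <= 1) && (cdf (f tt y) y - u * atom (f tt y) y <= x))%R then 1 else 0)%:E)%E.
Proof.
rewrite /rcont CcdfE DmassE.
pose P u := (0 <= u <= 1) && (cdf (f tt y) y - u * atom (f tt y) y <= x).
have mP : measurable [set u | P u].
  rewrite -[X in measurable X]setTI.
  apply: (measurable_and (measurable_and _ _) _) => //; apply: measurable_fun_ler => //.
  by apply: measurable_funB => //; apply: measurable_funM.
rewrite (_ : _ `&` _ = [set u | P u] `&` setT); last first.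
  rewrite setIT; apply/seteqP; split => u /=; rewrite /P lee_fin.
    by case=> -> ->.
  by case/andP.
rewrite -integral_indic//; apply: eq_integral => u _.
rewrite indicE (_ : (u \in _) = P u); last by apply/idP/idP; rewrite inE.
by rewrite -/(P u); case: (P u).
Qed.

Lemma rcont_ge0 x tt y : (0 <= rcont mu phi f x tt y)%E.
Proof. exact: measure_ge0. Qed.

Lemma RrankE_rcont M i tt y : (i < M)%N ->
  Rrank mu phi f M i tt y =
  (\int[lebesgue_measure]_x ((order_density M i x)%:E * rcont mu phi f x tt y))%E.
Proof.
move=> iM; set c := cdf (f tt y) y; set d := atom (f tt y) y.
pose F (p : R * R) : \bar R := (if (0 <= p.1 <= 1) && (c - p.1 * d <= p.2)
  then order_density M i p.2 else 0)%:E.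
have F_ge0 p : (0 <= F p)%E by rewrite lee_fin; case: ifP => // _; exact: order_density_ge0.
have mF : measurable_fun setT F.
  apply/measurable_EFinP; apply: measurable_fun_ifT => //.
    apply: measurable_and.
      by apply: measurable_and; apply: measurable_fun_ler.
    apply: measurable_fun_ler => //.
    by apply: measurable_funB => //; apply: measurable_funM.
  by apply: measurableT_comp => //; exact: measurable_order_density.
transitivity (\int[lebesgue_measure]_u \int[lebesgue_measure]_x F (u, x))%E.
  rewrite RrankE integral_mkcond; apply: eq_integral => u _.
  rewrite patchE mem_setE in_itv /= /F -/c -/d.
  case: (boolP (0 <= u <= 1)) => [/andP[u0 u1]|_] /=; last by rewrite integral0.
  rewrite integral_order_density_ge//.
  have := atom_ge0 (f tt y) y; have := atom_le_cdf (f tt y) y; have := cdf_le1 (f tt y) y.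
  rewrite -/c -/d => c1 dc d0; nra.
rewrite (fubini_tonelli (m1 := lebesgue_measure) (m2 := lebesgue_measure) F mF F_ge0).
apply: eq_integral => x _.
rewrite rcontE -ge0_integralZl//.
- apply: eq_integral => u _; rewrite /F /= -/c -/d -EFinM; congr EFin.
  by case: ifP; rewrite ?mulr1 ?mulr0.
- apply/measurable_EFinP; apply: measurable_fun_ifT => //.
  apply: (measurable_and (measurable_and _ _) _) => //; apply: measurable_fun_ler => //.
  by apply: measurable_funB => //; apply: measurable_funM.
- by move=> u _; rewrite lee_fin; case: ifP.
- by rewrite lee_fin order_density_ge0.
Qed.

Let measurable_integral_phi (P : rel R) :
  (forall g h : (Theta * Y) * Theta -> R, measurable_fun setT g -> measurable_fun setT h ->
     measurable_fun setT (fun p => P (g p) (h p))) ->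
  measurable_fun setT (fun p : Theta * Y =>
    fine (\int[mu]_(t in [set t | P (f t p.2) (f p.1 p.2)]) (phi t p.2)%:E)%E).
Proof.
move=> mP.
pose G (p : (Theta * Y) * Theta) : \bar R :=
  (if P (f p.2 p.1.2) (f p.1.1 p.1.2) then phi p.2 p.1.2 else 0)%:E.
have sw : measurable_fun setT (fun p : (Theta * Y) * Theta => (p.2, p.1.2)).
  by apply: measurable_fun_pair => //; exact: measurableT_comp.
have mG : measurable_fun setT G.
  apply/measurable_EFinP; apply: measurable_fun_ifT => //.
    apply: mP; first exact: (measurableT_comp Hf sw).
    exact: (measurableT_comp Hf measurable_fst).
  exact: (measurableT_comp measurable_phi sw).
have G_ge0 p : (0 <= G p)%E by rewrite lee_fin; case: ifP.
have := measurable_fun_fubini_tonelli_F (m2 := mu) G mG G_ge0.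
rewrite (_ : fubini_F _ _ = fun p : Theta * Y =>
  \int[mu]_(t in [set t | P (f t p.2) (f p.1 p.2)]) (phi t p.2)%:E)%E.
  by move=> mI; apply: measurableT_comp mI; exact: fine_measurable.
apply/funext => p; rewrite /fubini_F [RHS]integral_mkcond; apply: eq_integral => t _.
rewrite patchE /G /= (_ : (t \in _) = P (f t p.2) (f p.1 p.2)); last first.
  by apply/idP/idP; rewrite inE.
by case: ifP.
Qed.

Lemma measurable_cdf : measurable_fun setT (fun p : Theta * Y => cdf (f p.1 p.2) p.2).
Proof.
by apply: (measurable_integral_phi <=%R) => g h; exact: measurable_fun_ler.
Qed.

Lemma measurable_atom : measurable_fun setT (fun p : Theta * Y => atom (f p.1 p.2) p.2).
Proof.
have -> : (fun p : Theta * Y => atom (f p.1 p.2) p.2) = fun p =>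
    fine (\int[mu]_(t in [set t | f t p.2 == f p.1 p.2]) (phi t p.2)%:E)%E.
  apply/funext => p; rewrite /atom /Dmass; congr (fine (integral _ _ _)).
  by apply/seteqP; split => t /= /eqP.
by apply: (measurable_integral_phi (fun x y => x == y)) => g h; exact: measurable_fun_eqr.
Qed.

Lemma measurable_rcont : measurable_fun setT (fun p : (Theta * Y) * R =>
  rcont mu phi f p.2 p.1.1 p.1.2).
Proof.
pose G (p : ((Theta * Y) * R) * R) : \bar R := (if (0 <= p.2 <= 1) &&
  (cdf (f p.1.1.1 p.1.1.2) p.1.1.2 - p.2 * atom (f p.1.1.1 p.1.1.2) p.1.1.2 <= p.1.2)
  then 1 else 0)%:E.
have mfst : measurable_fun setT (fun p : ((Theta * Y) * R) * R => p.1.1).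
  exact: measurableT_comp.
have mG : measurable_fun setT G.
  apply/measurable_EFinP; apply: measurable_fun_ifT => //.
  apply: measurable_and.
    by apply: measurable_and; apply: measurable_fun_ler.
  apply: measurable_fun_ler; last exact: measurableT_comp.
  apply: measurable_funB; first exact: (measurableT_comp measurable_cdf mfst).
  by apply: measurable_funM => //; exact: (measurableT_comp measurable_atom mfst).
have G_ge0 p : (0 <= G p)%E by rewrite lee_fin; case: ifP.
have := measurable_fun_fubini_tonelli_F (m2 := lebesgue_measure) G mG G_ge0.
rewrite (_ : fubini_F _ _ = fun p : (Theta * Y) * R => rcont mu phi f p.2 p.1.1 p.1.2)//.
by apply/funext => p; rewrite rcontE.
Qed.

Section posterior.
Context (muY : {sigma_finite_measure set Y -> \bar R}) (prior : Theta -> R)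
  (obs : Y -> Theta -> R) (Hmodel : is_model mu muY prior obs).

Let obs_ge0 y t : 0 <= obs y t. Proof. by case: Hmodel => _ []. Qed.
Let prior_ge0 t : 0 <= prior t. Proof. by case: Hmodel => -[]. Qed.

Let measurable_joint : measurable_fun setT (fun p : Y * Theta => obs p.1 p.2 * prior p.2).
Proof.
case: Hmodel => -[mprior _ _] [mobs _ _].
by apply: measurable_funM => //; exact: measurableT_comp.
Qed.

Lemma marg_ge0 y : (0 <= marg mu prior obs y)%E.
Proof. by apply: integral_ge0 => t _; rewrite lee_fin mulr_ge0. Qed.

Lemma measurable_marg : measurable_fun setT (marg mu prior obs).
Proof.
apply: (measurable_fun_fubini_tonelli_F (m2 := mu)
  (fun p : Y * Theta => (obs p.1 p.2 * prior p.2)%:E)).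
  exact/measurable_EFinP.
by move=> p; rewrite lee_fin mulr_ge0.
Qed.

Lemma post_ge0 t y : 0 <= post mu prior obs t y.
Proof. by rewrite mulr_ge0 ?mulr_ge0// invr_ge0 fine_ge0// marg_ge0. Qed.

Lemma measurable_post :
  measurable_fun setT (fun p : Y * Theta => post mu prior obs p.2 p.1).
Proof.
rewrite (_ : (fun _ => _) = fun p : Y * Theta =>
  obs p.1 p.2 * prior p.2 * fine (marg mu prior obs p.1) `^ (-1)); last first.
  by apply/funext => p; rewrite powR_inv1// fine_ge0// marg_ge0.
have mfine : measurable_fun setT (fun p : Y * Theta => fine (marg mu prior obs p.1)).
  apply: (measurableT_comp (fine_measurable measurableT)).
  exact: (measurableT_comp measurable_marg).
by apply: measurable_funM => //; exact: (measurableT_comp (measurable_powR (-1)) mfine).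
Qed.

Let measurable_post_rcont : measurable_fun setT (fun p : (Y * R) * Theta =>
  ((post mu prior obs p.2 p.1.1)%:E * rcont mu phi f p.1.2 p.2 p.1.1)%E).
Proof.
have m1 : measurable_fun setT (fun p : (Y * R) * Theta => (p.1.1, p.2)).
  by apply: measurable_fun_pair => //; exact: measurableT_comp.
have m2 : measurable_fun setT (fun p : (Y * R) * Theta => ((p.2, p.1.1), p.1.2)).
  apply: measurable_fun_pair; last exact: measurableT_comp.
  by apply: measurable_fun_pair => //; exact: measurableT_comp.
apply: emeasurable_funM; last exact: (measurableT_comp measurable_rcont m2).
apply/measurable_EFinP; exact: (measurableT_comp measurable_post m1).
Qed.

Lemma qcont_ge0 x y : (0 <= qcont mu prior obs phi f x y)%E.
Proof.
by apply: integral_ge0 => t _; rewrite mule_ge0 ?rcont_ge0// lee_fin post_ge0.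
Qed.

Lemma measurable_qcont : measurable_fun setT (fun p : Y * R =>
  qcont mu prior obs phi f p.2 p.1).
Proof.
apply: (measurable_fun_fubini_tonelli_F (m2 := mu) _ measurable_post_rcont) => p.
by rewrite mule_ge0 ?rcont_ge0// lee_fin post_ge0.
Qed.

Lemma QrankE_qcont M i y : (i < M)%N ->
  Qrank mu prior obs phi f M i y =
  (\int[lebesgue_measure]_x ((order_density M i x)%:E * qcont mu prior obs phi f x y))%E.
Proof.
move=> iM.
pose F (p : Theta * R) := ((order_density M i p.2)%:E *
  ((post mu prior obs p.1 y)%:E * rcont mu phi f p.2 p.1 y))%E.
have od_ge0 (x : R) : (0 <= (order_density M i x)%:E)%E by rewrite lee_fin order_density_ge0.
have pr_ge0 t x : (0 <= (post mu prior obs t y)%:E * rcont mu phi f x t y)%E.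
  by rewrite mule_ge0 ?rcont_ge0// lee_fin post_ge0.
have mpr : measurable_fun setT (fun p : Theta * R =>
    (post mu prior obs p.1 y)%:E * rcont mu phi f p.2 p.1 y)%E.
  have m : measurable_fun setT (fun p : Theta * R => ((y, p.2), p.1)).
    by apply: measurable_fun_pair => //; exact: measurable_fun_pair.
  exact: (measurableT_comp measurable_post_rcont m).
have mod : measurable_fun setT (EFin \o @order_density R M i).
  by apply/measurable_EFinP; exact: measurable_order_density.
have mF : measurable_fun setT F.
  by apply: emeasurable_funM => //; exact: (measurableT_comp mod measurable_snd).
have F_ge0 p : (0 <= F p)%E by rewrite mule_ge0.
transitivity (\int[mu]_t \int[lebesgue_measure]_x F (t, x))%E.
  apply: eq_integral => t _; rewrite (RrankE_rcont _ _ _ _ iM) -ge0_integralZl//.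
  - by apply: eq_integral => x _; rewrite /F muleCA.
  - apply: emeasurable_funM => //.
    exact: (measurable_fun_pair2 (t, y) measurable_rcont).
  - by move=> x _; rewrite mule_ge0// rcont_ge0.
  - by rewrite lee_fin post_ge0.
rewrite (fubini_tonelli (m1 := mu) (m2 := lebesgue_measure) F mF F_ge0).
apply: eq_integral => x _.
rewrite /F /= ge0_integralZl//.
exact: (measurable_fun_pair1 x mpr).
Qed.

Lemma Qrank_pointwise M i y : (i < M)%N ->
  (forall x, 0 <= x <= 1 -> qcont mu prior obs phi f x y = x%:E) ->
  Qrank mu prior obs phi f M i y = (i.+1%:R / M.+1%:R)%:E.
Proof.
move=> iM hq; rewrite QrankE_qcont// -integral_order_density_id//.
apply: eq_integral => x _.
have [x01|x01] := boolP (0 <= x <= 1); first by rewrite hq// EFinM.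
by rewrite /order_density (negbTE x01) mul0e mul0r.
Qed.

Lemma integral_Qrank M i : (i < M)%N ->
  (\int[muY]_y (Qrank mu prior obs phi f M i y * marg mu prior obs y) =
   \int[lebesgue_measure]_x ((order_density M i x)%:E *
     \int[muY]_y (qcont mu prior obs phi f x y * marg mu prior obs y)))%E.
Proof.
move=> iM.
pose F (p : Y * R) := ((order_density M i p.2)%:E *
  (qcont mu prior obs phi f p.2 p.1 * marg mu prior obs p.1))%E.
have od_ge0 (x : R) : (0 <= (order_density M i x)%:E)%E by rewrite lee_fin order_density_ge0.
have mqm : measurable_fun setT (fun p : Y * R =>
    qcont mu prior obs phi f p.2 p.1 * marg mu prior obs p.1)%E.
  apply: emeasurable_funM; first exact: measurable_qcont.
  exact: (measurableT_comp measurable_marg).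
have mod : measurable_fun setT (EFin \o @order_density R M i).
  by apply/measurable_EFinP; exact: measurable_order_density.
have mF : measurable_fun setT F.
  by apply: emeasurable_funM => //; exact: (measurableT_comp mod measurable_snd).
have qm_ge0 x y : (0 <= qcont mu prior obs phi f x y * marg mu prior obs y)%E.
  by rewrite mule_ge0 ?qcont_ge0 ?marg_ge0.
have F_ge0 p : (0 <= F p)%E by rewrite mule_ge0.
transitivity (\int[muY]_y \int[lebesgue_measure]_x F (y, x))%E.
  apply: eq_integral => y _; rewrite (QrankE_qcont _ _ _ iM) -ge0_integralZr//.
  - by apply: eq_integral => x _; rewrite /F muleA.
  - apply: emeasurable_funM => //; exact: (measurable_fun_pair2 y measurable_qcont).
  - by move=> x _; rewrite mule_ge0// qcont_ge0.
  - exact: marg_ge0.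
rewrite (fubini_tonelli (m1 := muY) (m2 := lebesgue_measure) F mF F_ge0).
apply: eq_integral => x _.
rewrite /F /= ge0_integralZl//.
exact: (measurable_fun_pair1 x mqm).
Qed.

End posterior.
End rank_statistics.

Theorem theorem3 (R : realType) (dT dY : measure_display)
  (Theta : measurableType dT) (Y : measurableType dY)
  (muT : {measure set Theta -> \bar R}) (muY : {measure set Y -> \bar R})
  (sfT : sigma_finite setT muT) (sfY : sigma_finite setT muY)
  (prior : Theta -> R) (obs : Y -> Theta -> R)
  (Hmodel : is_model muT muY prior obs)
  (phi : Theta -> Y -> R) (Hphi : posterior_family muT phi)
  (f : Theta -> Y -> R) (Hf : test_quantity f) (M : nat) :
  (forall y : Y,
     (forall x : R, 0 <= x <= 1 -> qcont muT prior obs phi f x y = x%:E) ->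
     forall i : nat, (i < M)%N ->
       Qrank muT prior obs phi f M i y = (i.+1%:R / M.+1%:R)%:E)
  /\
  (passes_continuous_SBC muT muY prior obs phi f ->
   passes_M_SBC muT muY prior obs phi f M).
Proof.
have [mT mTE] := sigma_finite_measureP _ _ _ _ sfT.
have [mY mYE] := sigma_finite_measureP _ _ _ _ sfY.
subst muT muY; split=> [y hq i iM|hq i iM].
  exact: (Qrank_pointwise mT phi f Hphi Hf mY prior obs Hmodel).
rewrite (integral_Qrank mT phi f Hphi Hf mY prior obs Hmodel)// -integral_order_density_id//.
apply: eq_integral => x _.
have [x01|x01] := boolP (0 <= x <= 1); first by rewrite hq// EFinM.
by rewrite /order_density (negbTE x01) mul0e mul0r.
Qed.
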